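(* Let $(X,\widehat X,\widetilde X)$ be a compactification pack and let $\mathcal E$ be the topological coarse structure over $\widehat X$ attached to the compactification $\widetilde X$. If $\alpha$ is a family of subsets of $\widehat X$, then $\alpha$ is uniform (for $\mathcal E$) if and only if for every $x\in X$ and every neighborhood $V_x$ of $x$ in $\widetilde X$ there exists a neighborhood $W_x$ of $x$ in $\widetilde X$ such that $\alpha(W_x)\subset V_x$. In particular, $\alpha$ is a canonical cover of $(X,\widehat X,\widetilde X)$ if and only if it is an open and locally finite cover of $\widehat X$ which is uniform for $\mathcal E$.
   Context: A compactification pack is a triple $(X,\widehat X,\widetilde X)$ where $\widetilde X$ is a compact Hausdorff space, $X$ is a nowhere dense closed subset of $\widetilde X$, and $\widehat X=\widetilde X\setminus X$. For $E\subset\widehat X\times\widehat X$ and a set $K$: $E(K)=\{y:\exists x\in K,\ (y,x)\in E\}$, $E^{-1}=\{(y,x):(x,y)\in E\}$; $E$ is proper if $E(K)$ and $E^{-1}(K)$ are relatively compact in $\widehat X$ for every relatively compact $K\subset\widehat X$. The topological coarse structure $\mathcal E$ over $\widehat X$ attached to $\widetilde X$ is the collection of all $E\subset\widehat X\times\widehat X$ satisfying any of the following equivalent properties: (i) the closure of $E$ in $\widetilde X\times\widetilde X$ meets $(\widetilde X\times\widetilde X)\setminus(\widehat X\times\widehat X)$ only in the diagonal of $X\times X$; (ii) $E$ is proper and for every net $(x_\lambda,y_\lambda)$ in $E$, if $x_\lambda$ converges to a point $x\in X$ then $y_\lambda$ also converges to $x$; (iii) $E$ is proper and for every $x\in X$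 and every neighborhood $V_x$ of $x$ in $\widetilde X$ there is a neighborhood $W_x$ of $x$ in $\widetilde X$ with $E(W_x)\subset V_x$. A family $\alpha$ of subsets of $\widehat X$ is uniform if $\bigcup_{U\in\alpha}U\times U\in\mathcal E$. For a set $A$, $\alpha(A)=\bigcup\{U\in\alpha:U\cap A\neq\varnothing\}$. A canonical cover of $(X,\widehat X,\widetilde X)$ is an open and locally finite cover $\alpha$ of $\widehat X$ such that for every $x\in X$ and every neighborhood $V_x$ of $x$ in $\widetilde X$ there is a neighborhood $W_x$ of $x$ in $\widetilde X$ with $\alpha(W_x)\subset V_x$. *)

(* Defs.v *)
(* MathComp-Analysis *)
From mathcomp Require Import all_boot.
From mathcomp Require Import boolp classical_sets functions cardinality.
From mathcomp Require Import topology.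

Set Implicit Arguments.
Unset Strict Implicit.
Unset Printing Implicit Defensive.

Local Open Scope classical_set_scope.

Definition nowhere_dense (T : topologicalType) (A : set T) : Prop :=
  interior (closure A) = set0.

(* [T] is the compactification and [X] its boundary; the middle component of
   the triple is determined by [X], see [hat]. Subsets of [hat X] are
   represented as sets [U] of points of [T] with [U `<=` hat X]. *)
Record compactification_pack (T : topologicalType) (X : set T) : Prop :=
  CompactificationPack {
    pack_compact : compact [set: T] ;
    pack_hausdorff : hausdorff_space T ;
    pack_closed : closed X ;
    pack_nowhere_dense : nowhere_dense X }.

Definition hat (T : Type) (X : set T) : set T := ~` X.

(* The closure is taken in the product topology of [T * T]. *)
Definition topological_coarse_structure (T : topologicalType) (X : set T) :
    set (set (T * T)) :=
  [set E | E `<=` hat X `*` hat X /\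
           closure E `&` ~` (hat X `*` hat X) `<=` diagonal `&` (X `*` X)].

Definition uniform_family (T : Type) (coarse : set (set (T * T)))
    (alpha : set (set T)) : Prop :=
  coarse (\bigcup_(U in alpha) (U `*` U)).

Definition star (T : Type) (alpha : set (set T)) (A : set T) : set T :=
  \bigcup_(U in [set U | alpha U /\ U `&` A !=set0]) U.

Definition family_in (T : Type) (Y : set T) (alpha : set (set T)) : Prop :=
  forall U, alpha U -> U `<=` Y.

(* Openness and neighborhoods are those of [subspace Y]; at points of [Y], and
   for subsets of [Y], they are the relative ones. *)
Definition open_family_in (T : topologicalType) (Y : set T)
    (alpha : set (set T)) : Prop :=
  forall U, alpha U -> open (U : set (subspace Y)).

Definition locally_finite_in (T : topologicalType) (Y : set T)
    (alpha : set (set T)) : Prop :=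
  forall y, Y y -> exists2 N : set T, nbhs (y : subspace Y) N &
    finite_set [set U | alpha U /\ U `&` N !=set0].

Definition open_locally_finite_cover (T : topologicalType) (Y : set T)
    (alpha : set (set T)) : Prop :=
  [/\ family_in Y alpha, cover alpha id = Y,
      open_family_in Y alpha & locally_finite_in Y alpha].

Definition canonical_cover (T : topologicalType) (X : set T)
    (alpha : set (set T)) : Prop :=
  open_locally_finite_cover (hat X) alpha /\
  forall x, X x -> forall V, nbhs x V ->
    exists2 W, nbhs x W & star alpha W `<=` V.

(* Main.v *)
Require Import Defs.
From mathcomp Require Import all_boot.
From mathcomp Require Import boolp classical_sets functions cardinality.
From mathcomp Require Import topology.

(** Both conditions speak of the relation E, the union of the squares
    [U `*` U] with [U] in [alpha]: [star alpha W] is the image of [W] under E.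
    Uniformity says that a point of the closure of E with a coordinate in [X]
    is a diagonal point, and the star condition says that E maps points close
    to [x] to points close to [x].

    The first gives the second by compactness ([star_small_of_closure]): since
    no point [(x, y)] with [y <> x] adheres to E, every [y] outside a given
    neighborhood of [x] has a product neighborhood of [(x, y)] that misses E,
    and compactness makes the neighborhoods of [x] uniform in [y].
    The second gives the first by separation ([closure_of_star_small]): if
    [(x, y)] adheres to E and [x <> y], disjoint neighborhoods of [x] and [y]
    contradict the smallness of stars around [x]. As E is symmetric, it is
    enough to treat points whose first coordinate lies in [X]. *)

Local Open Scope classical_set_scope.

Definition squares {T : Type} (alpha : set (set T)) : set (T * T) :=
  \bigcup_(U in alpha) (U `*` U).

Lemma squares_sym {T : Type} {alpha : set (set T)} {x y : T} :
  squares alpha (x, y) -> squares alpha (y, x).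
Proof. by move=> [U aU [/= Ux Uy]]; exists U. Qed.

Lemma star_squares {T : Type} {alpha : set (set T)} {A : set T} {y : T} :
  star alpha A y <-> exists2 x, A x & squares alpha (x, y).
Proof.
split=> [[U [aU [x [Ux Ax]]] Uy]|[x Ax [U aU [/= Ux Uy]]]].
  by exists x => //; exists U.
by exists U => //; split=> //; exists x.
Qed.

Lemma closure_squares_sym {T : topologicalType} {alpha : set (set T)}
    {x y : T} :
  closure (squares alpha) (x, y) -> closure (squares alpha) (y, x).
Proof.
move=> cl B [[B1 B2] /= [B1y B2x] B12].
have [|[a b] [Eab [/= B2a B1b]]] := cl (B2 `*` B1).
  by exists (B2, B1).
by exists (b, a); split; [exact: squares_sym|exact: B12].
Qed.

(** A tube argument: for each [y], points near [(x, y)] lie outside E if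
    [y <> x], and have their second coordinate in [V] if [y = x]; compactness
    yields one neighborhood of [x] that works for all [y]. *)
Lemma star_small_of_closure {T : topologicalType} {alpha : set (set T)}
    {x : T} {V : set T} :
  compact [set: T] ->
  (forall y, closure (squares alpha) (x, y) -> x = y) ->
  nbhs x V -> exists2 W, nbhs x W & star alpha W `<=` V.
Proof.
move=> /compact_near_coveringP cT diag xV.
pose P (a b : T) := squares alpha (a, b) -> V b.
have xP : \forall a \near x, [set: T] `<=` P a.
  apply: cT => y _; have [<-|xy] := EM (x = y).
    by exists (V, setT) => [|[b a] [/= Vb _] _]; [split=> //; exact: filterT|].
  have /existsNP[B /not_implyP[[[B1 B2] /= [B1x B2y] B12] EB]] :
      ~ closure (squares alpha) (x, y) by move=> /diag.
  exists (B2, B1) => // -[b a] [/= B2b B1a] Eab.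
  by exfalso; apply: EB; exists (a, b); split=> //; exact: B12.
exists [set a | [set: T] `<=` P a] => // b /star_squares[a Pa].
exact: Pa.
Qed.

Lemma closure_of_star_small {T : topologicalType} {alpha : set (set T)}
    {x y : T} :
  hausdorff_space T ->
  (forall V, nbhs x V -> exists2 W, nbhs x W & star alpha W `<=` V) ->
  closure (squares alpha) (x, y) -> x = y.
Proof.
move=> hT small cl; apply: hT => A B xA yB.
have [W xW WA] := small A xA.
have [|[a b] [Eab [/= Wa Bb]]] := cl (W `*` B); first by exists (W, B).
by exists b; split=> //; apply/WA/star_squares; exists a.
Qed.

Lemma uniform_family_star {T : topologicalType} {X : set T}
    {alpha : set (set T)} :
  compactification_pack X -> family_in (hat X) alpha ->
  uniform_family (topological_coarse_structure X) alpha <->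
  forall x, X x -> forall V, nbhs x V ->
    exists2 W, nbhs x W & star alpha W `<=` V.
Proof.
move=> [cT hT _ _] alpha_hat; split=> [[_ cl] x Xx V|small].
  apply: star_small_of_closure => // y Exy.
  by have [|] := cl (x, y); [split=> // -[]|].
split=> [[a b] [U aU [/= Ua Ub]]|[x y] [Exy nhat]].
  by split; exact: alpha_hat Ua || exact: alpha_hat Ub.
have [Xx|nXx] := EM (X x).
  have eq_xy : x = y by apply: closure_of_star_small Exy => //; exact: small.
  by subst y.
have Xy : X y by apply: contrapT => nXy; exact: nhat.
have eq_yx : y = x.
  by apply: closure_of_star_small (closure_squares_sym Exy) => //; exact: small.
by subst y.
Qed.

Theorem corollary7 (T : topologicalType) (X : set T)
    (packTX : compactification_pack X)
    (alpha : set (set T)) (alpha_hat : family_in (hat X) alpha) :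
  (uniform_family (topological_coarse_structure X) alpha <->
   forall x, X x -> forall V, nbhs x V ->
     exists2 W, nbhs x W & star alpha W `<=` V)
  /\
  (canonical_cover X alpha <->
   open_locally_finite_cover (hat X) alpha /\
   uniform_family (topological_coarse_structure X) alpha).
Proof.
have unif := uniform_family_star packTX alpha_hat.
by split=> //; split=> -[cov] /unif.
Qed.
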